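(* There is a linearly ordered set $Z$ satisfying the following conditions (1), (2) and (3'), such that $\mathbb{K}(Z)$ is not Valdivia compact: (1) $|Z|\le\aleph_1$. (2) Every bounded monotone $\omega_1$-sequence in $Z$ has a limit in $Z$; that is, every increasing sequence $(x_\alpha)_{\alpha<\omega_1}$ in $Z$ which is bounded from above in $Z$ has a supremum in $Z$, and every decreasing sequence $(x_\alpha)_{\alpha<\omega_1}$ in $Z$ which is bounded from below in $Z$ has an infimum in $Z$. (3') Every uncountable subset of $Z$ contains either a copy of $\omega_1$ or a copy of $\omega_1^{-1}$.
   Context: A compact space $K$ is Valdivia (compact) if there are a set $\Gamma$ and a homeomorphism of $K$ onto some $K'\subseteq\mathbb{R}^\Gamma$ such that $\{x\in K' : \{\gamma\in\Gamma : x(\gamma)\neq 0\}\text{ is countable}\}$ is dense in $K'$. For a linearly ordered set $X$, $\mathbb{K}(X)$ denotes the set of all final segments of $X$ (sets $F\subseteq X$ such that $x\in F$ and $x\le y$ imply $y\in F$; $\emptyset$ and $X$ are included), with the topology inherited from the Cantor cube $\{0,1\}^X$ by identifying each final segment with its characteristic function. It is ordered by inverse inclusion, and is a zero-dimensional compact line (a compact space whose topology is induced by its linear order). Increasing and decreasing are meant in the non-strict sense. $\omega_1^{-1}$ denotes $\omega_1$ with the reversed ordering; a copy of a linearly ordered set is a subset order-isomorphic to it (with the induced order). *)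

(* Defs.v *)
From HB Require Import structures.
From mathcomp Require Import all_boot all_order all_algebra.
From mathcomp Require Import all_classical all_reals all_analysis.
From mathcomp Require wochoice.
Import Order.TTheory GRing.Theory Num.Theory.
Import numFieldNormedType.Exports.

Set Implicit Arguments.
Unset Strict Implicit.
Unset Printing Implicit Defensive.

Local Open Scope classical_set_scope.
Local Open Scope ring_scope.

(* Fix a well-ordering of [set nat].  The points with countably many strict
   predecessors form an uncountable initial segment all of whose proper initial
   segments are countable, that is, a well-ordered set of order type omega_1;
   see [omega1_min], [omega1_countable_lt] and [omega1_uncountable]. *)
Definition continuum_le : rel (set nat) :=
  projT1 (wochoice.well_ordering_principle (set nat)).

Definition strictly_below (x : set nat) : set (set nat) :=
  [set y | continuum_le y x /\ y <> x].

Definition omega1 : Type := {x : set nat | `[< countable (strictly_below x) >]}.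

HB.instance Definition _ :=
  Choice.copy omega1 {x : set nat | `[< countable (strictly_below x) >]}.

Definition omega1_le (x y : omega1) : bool := continuum_le (sval x) (sval y).

Lemma continuum_le_wo : wochoice.well_order continuum_le.
Proof. exact: projT2 (wochoice.well_ordering_principle (set nat)). Qed.

Lemma continuum_le_min (A : set (set nat)) :
  A !=set0 -> exists2 z, A z & forall x, A x -> continuum_le z x.
Proof.
move=> [a Aa]; have [|z [[Az zle] _]] := continuum_le_wo (A := mem A).
  by exists a; rewrite inE.
by exists z => [|x Ax]; [rewrite inE in Az | apply: zle; rewrite inE].
Qed.

Lemma continuum_le_total : total continuum_le.
Proof.
move=> x y; have [|z [->|->] zle] := continuum_le_min (A := [set x; y]).
- by exists x; left.
- by apply/orP; left; apply: zle; right.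
- by apply/orP; right; apply: zle; left.
Qed.

Lemma continuum_le_refl : reflexive continuum_le.
Proof. by move=> x; have := continuum_le_total x x; rewrite orbb. Qed.

Lemma continuum_le_anti : antisymmetric continuum_le.
Proof.
move=> x y /andP[xy yx].
have [|z [_ zuniq]] := continuum_le_wo (A := mem [set x; y]).
  by exists x; rewrite inE; left.
transitivity z; [symmetry|]; apply: zuniq; split; rewrite ?inE.
- by left.
- by move=> t; rewrite inE => -[->|->] //; exact: continuum_le_refl.
- by right.
- by move=> t; rewrite inE => -[->|->] //; exact: continuum_le_refl.
Qed.

Lemma continuum_le_trans : transitive continuum_le.
Proof.
move=> y x z xy yz.
have [|t Ht tle] := continuum_le_min (A := [set x; y; z]).
  by exists x; left; left.
have := tle x; have := tle y; have := tle z => /(_ (or_intror erefl)) tz.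
move=> /(_ (or_introl (or_intror erefl))) ty.
move=> /(_ (or_introl (or_introl erefl))) tx.
case: Ht => [[tE|tE]|tE]; first by rewrite -tE.
- suff -> : x = y by [].
  by apply: continuum_le_anti; rewrite xy -tE.
- suff <- : y = z by [].
  by apply: continuum_le_anti; rewrite yz -tE.
Qed.

Lemma omega1_le_anti : antisymmetric omega1_le.
Proof. by move=> x y /continuum_le_anti/val_inj. Qed.

Lemma omega1_le_trans : transitive omega1_le.
Proof. by move=> y x z; exact: continuum_le_trans. Qed.

Lemma omega1_le_total : total omega1_le.
Proof. by move=> x y; exact: continuum_le_total. Qed.

Fact omega1_display : Order.disp_t. Proof. exact: Order.Disp tt tt. Qed.

HB.instance Definition _ := Order.isOrder.Build omega1_display omega1
  (fun _ _ => erefl) (fun _ _ => erefl) (fun _ _ => erefl)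
  omega1_le_anti omega1_le_trans omega1_le_total.

Lemma omega1_min (A : set omega1) :
  A !=set0 -> exists2 z, A z & forall x, A x -> (z <= x)%O.
Proof.
move=> [a Aa]; have [|_ [z Az <-] zle] := continuum_le_min (A := sval @` A).
  by exists (sval a), a.
by exists z => // x Ax; apply: zle; exists x.
Qed.

Lemma omega1_countable_lt (x : omega1) : countable [set y | (y < x)%O].
Proof.
have /asboolP/countable_injP[f finj] := valP x.
apply/countable_injP; exists (f \o sval) => y z.
rewrite !inE /= => yx zx fyz; apply: val_inj; apply: finj; rewrite ?inE //.
- split; first exact: (ltW yx).
  by move=> /val_inj yE; move: yx; rewrite yE ltxx.
- split; first exact: (ltW zx).
  by move=> /val_inj zE; move: zx; rewrite zE ltxx.
Qed.

Lemma uncountable_set_nat : ~ countable [set: set nat].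
Proof.
move=> /countable_injP[f finj].
pose D := [set n | exists2 A, f A = n & ~ A n].
have [DD|nDD] := pselect (D (f D)).
  case: (DD) => A fA nA; apply: nA.
  by rewrite (finj A D) // inE.
by apply: (nDD); exists D.
Qed.

Lemma omega1_uncountable : ~ countable [set: omega1].
Proof.
move=> /countable_injP[f finj].
have cW : countable [set x | countable (strictly_below x)].
  apply/countable_injP.
  pose g x := if pselect (countable (strictly_below x)) is left cx
              then f (exist _ x (asboolT cx)) else 0%N.
  exists g => x y; rewrite !inE /g /= => cx cy.
  case: pselect => // cx'; case: pselect => // cy' /finj fxy.
  have [] // : exist _ x (asboolT cx') = exist _ y (asboolT cy') :> omega1.
  by apply: fxy; rewrite inE.
have [nc|/forallNP ac] := pselect (exists x, ~ countable (strictly_below x)).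
  have [x ncx xmin] := continuum_le_min nc; apply: ncx.
  apply: sub_countable cW; apply: subset_card_le => y [yx xy] /=.
  apply: contrapT => /xmin xley; apply: xy.
  by apply: continuum_le_anti; rewrite yx xley.
apply: uncountable_set_nat; apply: sub_countable cW; apply: subset_card_le.
by move=> x _; apply: contrapT; exact: ac.
Qed.

(* [C] is a copy of [W]: the two are order-isomorphic, with the order induced
   from [X] on [C]. *)
Definition copy_of (d : Order.disp_t) (W : orderType d)
    (d' : Order.disp_t) (X : orderType d') (C : set X) : Prop :=
  exists f : W -> X, {mono f : a b / (a <= b)%O} /\ range f = C.

Definition contains_copy_of (d : Order.disp_t) (W : orderType d)
    (d' : Order.disp_t) (X : orderType d') (A : set X) : Prop :=
  exists2 C : set X, copy_of W C & C `<=` A.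

Definition bounded_omega1_limits (d : Order.disp_t) (X : orderType d) : Prop :=
  (forall x : omega1 -> X, {homo x : a b / (a <= b)%O} ->
     has_ubound (range x) -> supremums (range x) !=set0) /\
  (forall x : omega1 -> X, {homo x : a b / (a <= b)%O >-> (b <= a)%O} ->
     has_lbound (range x) -> infimums (range x) !=set0).

Definition homeomorphic (S T : topologicalType) : Prop :=
  exists (f : S -> T) (g : T -> S),
    [/\ continuous f, continuous g, cancel f g & cancel g f].

(* The set [K'] is a type with the subspace topology of [R ^ Gamma], and
   density is relative to that space. *)
Definition valdivia (R : realType) (K : topologicalType) : Prop :=
  compact [set: K] /\
  exists (Gamma : Type) (K' : set (prod_topology (fun _ : Gamma => R))),
    homeomorphic K K' /\
    dense [set x : K' | countable [set gamma | sval x gamma != 0]].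

Definition final_segment (d : Order.disp_t) (X : orderType d) (F : set X) :
    Prop :=
  forall x y, F x -> (x <= y)%O -> F y.

Definition cantor_cube (X : Type) : topologicalType :=
  prod_topology (fun _ : X => bool).

Definition char_fun (X : Type) (F : set X) : cantor_cube X :=
  fun x => x \in F.

(* The space K(X), as the subspace of the Cantor cube consisting of the
   characteristic functions of the final segments of [X]. *)
Definition final_segments (d : Order.disp_t) (X : orderType d) :
    topologicalType :=
  [set char_fun F | F in @final_segment d X].

(* Main.v *)
Require Import Defs.
From HB Require Import structures.
From mathcomp Require Import all_boot all_order all_algebra.
From mathcomp Require Import all_classical all_reals all_analysis.
Import Order.TTheory GRing.Theory Num.Theory.
Import numFieldNormedType.Exports.

Set Implicit Arguments.
Unset Strict Implicit.
Unset Printing Implicit Defensive.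

Local Open Scope classical_set_scope.

(* For every countable ordinal d > 0 fix an enumeration e_d : nat -> omega_1 of
   the ordinals below d.  The line consists of the sequences e_d and of their
   finite truncations, ordered lexicographically, with the order of omega_1 at
   even coordinates and the reversed one at odd coordinates; a sequence that
   stops takes the value +oo from there on.

   Monotone omega_1-sequences stabilise coordinate by coordinate, except that at
   some coordinate n they may increase to omega_1 (for the order of that
   coordinate), and then the common truncation to n is the limit.  An uncountable
   set has a node with uncountably many successors, which yields a copy of
   omega_1 or of its reverse according to the parity of the node.

   Suppose that K(Z) is embedded in a cube R^Gamma with a dense set of points of
   countable support.  By compactness a coordinate function c separates
   [z, ->) and (z, ->) for only countably many z.  For each pair s <> t in Z
   choose a point of countable support among the final segments that separate s
   from t, and let B(s, t) be the countable set of all z at which some c in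
   its support jumps.  A closing-off argument gives d such that for all
   truncations s, t of e_d the values of the elements of B(s, t) are bounded
   below d.  Some c jumps at z = e_d, hence is nonzero at one of the two ends of
   the jump.  That end is a limit of points chosen for pairs of truncations of
   e_d, so c is in the support of one of them and e_d lies in B(s, t), although
   its values are cofinal in d. *)

(** * Bounds, recursion and closure points in [omega1] *)

Lemma omega1_countable_le (x : omega1) : countable [set y | (y <= x)%O].
Proof.
have -> : [set y | (y <= x)%O] = [set y | (y < x)%O] `|` [set x].
  apply/seteqP; split=> y /=; rewrite le_eqVlt.
    by move=> /orP[/eqP ->|]; [right|left].
  by move=> [->|->]; rewrite ?orbT ?eqxx.
rewrite setUC -bigcup2E; apply: bigcup_countable => // -[|[|i]] _ //=.
exact: omega1_countable_lt.
Qed.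

Lemma omega1_strict_ubound (A : set omega1) :
  countable A -> exists b, forall a, A a -> (a < b)%O.
Proof.
move=> cA; apply: contrapT => /forallNP nb; apply: omega1_uncountable.
have cU : countable (\bigcup_(a in A) [set y | (y <= a)%O]).
  by apply: bigcup_countable => // a _; exact: omega1_countable_le.
apply: sub_countable cU; apply: subset_card_le => b _.
have /existsNP[a /not_implyP[Aa /negP]] := nb b.
by rewrite -leNgt => ba; exists a.
Qed.

Lemma omega1_strict_ubound2 (A : set omega1) (x : omega1) :
  countable A -> exists2 b, (x < b)%O & forall a, A a -> (a < b)%O.
Proof.
move=> cA; have [|b bA] := @omega1_strict_ubound (A `|` [set x]).
  by rewrite setUC -bigcup2E; apply: bigcup_countable => // -[|[|i]] _ /=.
by exists b => [|a Aa]; apply: bA; [right|left].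
Qed.

Lemma omega1_uncountable_unbounded (A : set omega1) (b : omega1) :
  ~ countable A -> exists2 a, A a & (b < a)%O.
Proof.
move=> ncA; apply: contrapT => nb; apply: ncA.
apply: sub_countable (omega1_countable_le b); apply: subset_card_le => a Aa /=.
by rewrite leNgt; apply/negP => ba; apply: nb; exists a.
Qed.

Lemma omega1_wf : well_founded (fun a b : omega1 => (a < b)%O).
Proof.
move=> a; apply: contrapT => na.
have [|m nm mmin] := @omega1_min [set a | ~ Acc (fun a b : omega1 => (a < b)%O) a].
  by exists a.
apply: nm; constructor => y ym; apply: contrapT => /mmin.
by rewrite leNgt ym.
Qed.

(** By well-founded recursion, [g x] is chosen in [V] above the values at all predecessors of [x]:
    these values are countably many, hence bounded, and [V] is unbounded. *)
Lemma omega1_embedding (X : Type) (lt : X -> X -> Prop) (V : set omega1) :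
    well_founded lt -> (forall x, countable [set y | lt y x]) ->
    ~ countable V ->
  exists g : X -> omega1,
    (forall x, V (g x)) /\ (forall x y, lt x y -> (g x < g y)%O).
Proof.
move=> wf_lt cI ncV.
have [v0 _] : V !=set0 by apply/set0P/eqP => V0; apply: ncV; rewrite V0.
pose next (C : set omega1) :=
  xget v0 [set v | V v /\ forall c, C c -> (c < v)%O].
have nextP C : countable C -> V (next C) /\ forall c, C c -> (c < next C)%O.
  move=> cC; apply: (@xgetPex _ v0 [set v | V v /\ forall c, C c -> (c < v)%O]).
  have [b bC] := omega1_strict_ubound cC.
  have [v Vv bv] := omega1_uncountable_unbounded b ncV.
  by exists v; split=> // c /bC cb; exact: lt_trans bv.
pose F x (rec : forall y, lt y x -> omega1) :=
  next [set c | exists y (yx : lt y x), c = rec y yx].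
pose g := Fix wf_lt (fun=> omega1) F.
have gE x : g x = next (g @` [set y | lt y x]).
  rewrite /g Fix_eq.
    congr next; apply/seteqP; split=> c /=; first by move=> [y [yx ->]]; exists y.
    by move=> [y yx <-]; exists y, yx.
  move=> {}x f h fh; congr next; apply/seteqP.
  by split=> c /= [y [yx ->]]; exists y, yx; rewrite fh.
have cg x : countable (g @` [set y | lt y x]).
  exact: sub_countable (card_image_le _ _) (cI x).
exists g; split=> [x|x y xy]; first by rewrite gE; have [] := nextP _ (cg x).
by rewrite [in X in (_ < X)%O]gE; apply: (nextP _ (cg y)).2; exists x.
Qed.

Lemma countable_seq (T : eqType) (S : set T) :
  countable S -> countable [set w : seq T | forall a, a \in w -> S a].
Proof.
move=> /countable_injP[f finj]; apply/countable_injP.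
exists (fun w => pickle (map f w)) => u v; rewrite !inE /= => Su Sv.
move=> /(pcan_inj (@pickleK _)).
elim: u v Su Sv => [|a u IH] [|b v] //= Su Sv [ab uv].
congr cons; first by apply: finj; rewrite ?inE //; [apply: Su|apply: Sv]; rewrite inE eqxx.
by apply: IH => // c cu; [apply: Su|apply: Sv]; rewrite inE cu orbT.
Qed.

(** Iterate a step that overtakes [phi] on all words below the current stage, and let [d] be the
    least strict bound of the iterates. A word below [d] has finitely many letters, so it already
    lies below one iterate. *)
Lemma omega1_closed_point (phi : seq omega1 -> omega1) :
  exists d : omega1, (exists b, (b < d)%O) /\
    forall w, (forall a, a \in w -> (a < d)%O) -> (phi w < d)%O.
Proof.
have [a0 _] : exists a : omega1, True.
  apply: contrapT => /forallNP noa; apply: omega1_uncountable.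
  by have -> : [set: omega1] = set0 by apply/seteqP; split=> a // _; case: (noa a).
have /choice[next nextP] (x : omega1) : exists y : omega1, (x < y)%O /\
    forall w, (forall a, a \in w -> (a < x)%O) -> (phi w < y)%O.
  have cphi : countable (phi @` [set w | forall a, a \in w -> (a < x)%O]).
    apply: sub_countable (card_image_le _ _) _.
    exact: countable_seq (omega1_countable_lt x).
  have [y xy yphi] := omega1_strict_ubound2 x cphi.
  by exists y; split=> // w wx; apply: yphi; exists w.
pose D := [set d | forall n, (iter n next a0 < d)%O].
have [|d dD dmin] := @omega1_min D.
  have [|b bP] := @omega1_strict_ubound (range (fun n => iter n next a0)).
    exact: sub_countable (card_image_le _ _) (countableP _).
  by exists b => n; apply: bP; exists n.
(* If no iterate exceeded [a], then [a] would bound them all strictly, since they strictly increase,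
   against the minimality of [d]. *)
have dlt a : (a < d)%O -> exists n, (a < iter n next a0)%O.
  move=> ad; apply: contrapT => /forallNP na.
  have : (d <= a)%O.
    apply: dmin => n; rewrite (@lt_le_trans _ _ (iter n.+1 next a0)) //=.
      exact: (nextP _).1.
    by rewrite leNgt; apply/negP/(na n.+1).
  by rewrite leNgt ad.
have mono m n : (m <= n)%N -> (iter m next a0 <= iter n next a0)%O.
  elim: n => [|n IH]; first by rewrite leqn0 => /eqP ->.
  rewrite leq_eqVlt => /orP[/eqP -> //|/IH /le_trans]; apply.
  exact/ltW/(nextP _).1.
exists d; split=> [|w wd]; first by exists a0; exact: dD 0%N.
suff [n wn] : exists n, forall a, a \in w -> (a < iter n next a0)%O.
  exact: lt_trans ((nextP _).2 _ wn) (dD n.+1).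
elim: w wd => [_|b w IH wd]; first by exists 0%N.
have [n1 n1P] := IH (fun a aw => wd a (mem_behead (s := b :: w) aw)).
have [n2 n2P] := dlt b (wd b (mem_head b w)).
exists (maxn n1 n2) => a; rewrite inE => /orP[/eqP ->|/n1P an1].
  exact: lt_le_trans n2P (mono _ _ (leq_maxr _ _)).
exact: lt_le_trans an1 (mono _ _ (leq_maxl _ _)).
Qed.

(** * Alternating lexicographic orders *)

Section AlternatingOrder.
Context (disp : Order.disp_t) (T : orderType disp).
Implicit Types (b : bool) (f g h : nat -> T).

Definition flip_lt b (x y : T) : bool := if b then (y < x)%O else (x < y)%O.

(** The flag [b] reverses the whole order, so that one proof serves suprema and infima. *)
Definition alt_lt b f g : Prop :=
  exists2 n, (forall m, (m < n)%N -> f m = g m) &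
             flip_lt (odd n (+) b) (f n) (g n).

Definition alt_le b f g : Prop := f = g \/ alt_lt b f g.

Lemma flip_ltxx b x : flip_lt b x x = false.
Proof. by rewrite /flip_lt ltxx if_same. Qed.

Lemma flip_lt_trans b x y z : flip_lt b x y -> flip_lt b y z -> flip_lt b x z.
Proof. by case: b => /= xy yz; [exact: lt_trans yz xy|exact: lt_trans xy yz]. Qed.

Lemma flip_lt_neg b x y : flip_lt (~~ b) x y = flip_lt b y x.
Proof. by case: b. Qed.

Lemma flip_lt_neq b x y : x <> y -> flip_lt b x y \/ flip_lt b y x.
Proof.
move=> /eqP; rewrite neq_lt => /orP[] xy; case: b.
- by right.
- by left.
- by left.
- by right.
Qed.

Lemma alt_ltxx b f : ~ alt_lt b f f.
Proof. by move=> [n _]; rewrite flip_ltxx. Qed.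

Lemma alt_lt_trans b f g h : alt_lt b f g -> alt_lt b g h -> alt_lt b f h.
Proof.
move=> [n fg fgn] [p gh ghp]; case: (ltngtP n p) => [np|pn|np].
- exists n; first by move=> m mn; rewrite fg // gh // (ltn_trans mn).
  by rewrite -gh.
- exists p; first by move=> m mp; rewrite fg ?gh // (ltn_trans mp).
  by rewrite fg.
- subst p; exists n; first by move=> m mn; rewrite fg ?gh.
  exact: flip_lt_trans ghp.
Qed.

Lemma alt_lt_asym b f g : alt_lt b f g -> ~ alt_lt b g f.
Proof. by move=> fg gf; exact: alt_ltxx (alt_lt_trans fg gf). Qed.

Lemma alt_le_lt_trans b f g h : alt_le b f g -> alt_lt b g h -> alt_lt b f h.
Proof. by move=> [->|] //; exact: alt_lt_trans. Qed.

Lemma alt_lt_neg b f g : alt_lt (~~ b) f g <-> alt_lt b g f.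
Proof.
split=> -[n fg fgn]; exists n; rewrite ?addbN ?flip_lt_neg // in fgn *;
  by move=> m mn; rewrite fg.
Qed.

Lemma alt_le_neg b f g : alt_le (~~ b) f g <-> alt_le b g f.
Proof. by split=> -[->|/alt_lt_neg]; by [left|right]. Qed.

Lemma first_difference f g : f <> g ->
  exists2 n, (forall m, (m < n)%N -> f m = g m) & f n <> g n.
Proof.
move=> fg; have [|n /eqP fgn nmin] := @ex_minnP (fun n => f n != g n).
  apply: contrapT => /forallNP E; apply: fg; apply/funext => n.
  by apply/eqP/negPn/negP; exact: E n.
exists n => // m mn; apply/eqP/negPn/negP => /nmin.
by rewrite leqNgt mn.
Qed.

Lemma alt_lt_total b f g : f <> g -> alt_lt b f g \/ alt_lt b g f.
Proof.
move=> /first_difference[n fg /(flip_lt_neq (odd n (+) b))[] fgn]; [left|right].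
  by exists n.
by exists n => // m mn; rewrite fg.
Qed.

Lemma alt_ltNge b f g : ~ alt_le b f g -> alt_lt b g f.
Proof.
move=> nfg; have [E|/(@alt_lt_total b)[fg|//]] := pselect (f = g).
  by case: nfg; left.
by case: nfg; right.
Qed.

(** Strict inequality is decided at one coordinate, hence survives any change beyond it; long
    truncations inherit it. *)
Lemma alt_lt_near_r b f g : alt_lt b f g ->
  exists m, forall h, (forall i, (i < m)%N -> h i = g i) -> alt_lt b f h.
Proof.
move=> [n fg fgn]; exists n.+1 => h hg; exists n; last by rewrite hg.
by move=> m mn; rewrite hg ?fg // ltnS ltnW.
Qed.

Lemma alt_lt_near_l b f g : alt_lt b f g ->
  exists m, forall h, (forall i, (i < m)%N -> h i = f i) -> alt_lt b h g.
Proof.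
move=> /alt_lt_neg/alt_lt_near_r[m mP]; exists m => h hf.
exact/alt_lt_neg/mP.
Qed.

Lemma alt_le_coord b n f g : (forall m, (m < n)%N -> f m = g m) ->
  alt_le b f g -> f n = g n \/ flip_lt (odd n (+) b) (f n) (g n).
Proof.
move=> fg [->|[p fgp fgpn]]; first by left.
case: (ltngtP n p) => [np|pn|np]; first by left; exact: fgp.
  by move: fgpn; rewrite fg // flip_ltxx.
by subst p; right.
Qed.

End AlternatingOrder.

(** * The coordinate order: [omega1] with a largest element [None] *)

Definition omega1_top : Type := option omega1.

HB.instance Definition _ := Choice.copy omega1_top (option omega1).

Definition omega1_top_le (x y : omega1_top) : bool :=
  if y is Some b then (if x is Some a then (a <= b)%O else false) else true.

Lemma omega1_top_le_anti : antisymmetric omega1_top_le.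
Proof. by move=> [a|] [b|] //= /le_anti ->. Qed.

Lemma omega1_top_le_trans : transitive omega1_top_le.
Proof. by move=> [b|] [a|] [c|] //=; exact: le_trans. Qed.

Lemma omega1_top_le_total : total omega1_top_le.
Proof. by move=> [a|] [b|] //=; exact: le_total. Qed.

Fact omega1_top_display : Order.disp_t. Proof. exact: Order.Disp tt tt. Qed.

HB.instance Definition _ := Order.isOrder.Build omega1_top_display omega1_top
  (fun _ _ => erefl) (fun _ _ => erefl) (fun _ _ => erefl)
  omega1_top_le_anti omega1_top_le_trans omega1_top_le_total.

Lemma lt_Some (a b : omega1) :
  ((Some a : omega1_top) < (Some b : omega1_top))%O = (a < b)%O.
Proof. by rewrite !lt_def. Qed.

Lemma lt_None (x : omega1_top) : (x < (None : omega1_top))%O = (x != None).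
Proof. by rewrite lt_def eq_sym andbT. Qed.

Lemma omega1_top_min (A : set omega1_top) :
  A !=set0 -> exists2 z, A z & forall x, A x -> (z <= x)%O.
Proof.
move=> [x Ax]; have [[a Aa]|/forallNP nA] := pselect (exists a, A (Some a)).
  have [|z Az zmin] := @omega1_min [set a | A (Some a)]; first by exists a.
  by exists (Some z) => // -[b /zmin|].
exists x => // -[b /nA //|_]; exact: (isT : (x <= None :> omega1_top)%O).
Qed.

(** * The line of enumerations and their truncations *)

Lemma initial_enumeration : exists e : omega1 -> nat -> omega1,
  forall d, (exists b, (b < d)%O) ->
    forall a, (exists n, e d n = a) <-> (a < d)%O.
Proof.
suff /choice[e eP] : forall d : omega1, exists u : nat -> omega1,
    (exists b, (b < d)%O) -> forall a, (exists n, u n = a) <-> (a < d)%O.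
  by exists e.
move=> d; have [[b bd]|nb] := pselect (exists b : omega1, (b < d)%O); last first.
  (* At the least element there is nothing to enumerate and the condition on [u] is vacuous. *)
  by exists (fun=> d).
have /countable_injP[f finj] := omega1_countable_lt d.
(* Numbers that code no predecessor get the default [b], which is still below [d]. *)
pose u n := xget b [set a | (a < d)%O /\ f a = n].
exists u => _ a; split=> [[n <-]|ad].
  by rewrite /u; case: xgetP => [x _ []|].
exists (f a); rewrite /u; case: xgetP => [x _ [xd fx]|/(_ a)[]//].
by apply: finj; rewrite ?inE.
Qed.

Definition initial_enum : omega1 -> nat -> omega1 := sval (cid initial_enumeration).

Lemma initial_enumP d : (exists b, (b < d)%O) ->
  forall a, (exists n, initial_enum d n = a) <-> (a < d)%O.
Proof. exact: (svalP (cid initial_enumeration)). Qed.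

(* Finite sequences are represented as functions that take the value [None]
   from some point on; [enum_trunc N d] with [N = None] is the whole
   enumeration of the ordinals below [d]. *)
Definition enum_trunc (N : option nat) (d : omega1) : nat -> omega1_top :=
  fun n => if N is Some m then (if (n < m)%N then Some (initial_enum d n) else None)
           else Some (initial_enum d n).

Definition alt_line : Type :=
  {f : nat -> omega1_top | `[< exists N d, f = enum_trunc N d >]}.

HB.instance Definition _ := Choice.copy alt_line
  {f : nat -> omega1_top | `[< exists N d, f = enum_trunc N d >]}.

Definition alt_line_le (x y : alt_line) : bool := `[< alt_le false (sval x) (sval y) >].

Lemma alt_line_le_anti : antisymmetric alt_line_le.
Proof.
move=> x y /andP[/asboolP[/val_inj //|xy] /asboolP[/val_inj //|yx]].
by case: (alt_lt_asym xy).
Qed.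

Lemma alt_line_le_trans : transitive alt_line_le.
Proof.
move=> y x z /asboolP xy /asboolP yz; apply/asboolP.
case: yz => [<- //|yz]; right; exact: alt_le_lt_trans yz.
Qed.

Lemma alt_line_le_total : total alt_line_le.
Proof.
move=> x y; have [xy|/(@alt_lt_total _ _ false)[xy|yx]] := pselect (sval x = sval y).
- by apply/orP; left; apply/asboolP; left; rewrite xy.
- by apply/orP; left; apply/asboolP; right.
- by apply/orP; right; apply/asboolP; right.
Qed.

Fact alt_line_display : Order.disp_t. Proof. exact: Order.Disp tt tt. Qed.

HB.instance Definition _ := Order.isOrder.Build alt_line_display alt_line
  (fun _ _ => erefl) (fun _ _ => erefl) (fun _ _ => erefl)
  alt_line_le_anti alt_line_le_trans alt_line_le_total.

Lemma alt_line_leP (x y : alt_line) :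
  reflect (alt_le false (sval x) (sval y)) (x <= y)%O.
Proof. exact: asboolP. Qed.

Lemma alt_line_ltP (x y : alt_line) :
  reflect (alt_lt false (sval x) (sval y)) (x < y)%O.
Proof.
rewrite ltNge; apply: (iffP negP) => [nyx|xy].
  by apply: alt_ltNge => yx; apply: nyx; exact/alt_line_leP.
move=> /alt_line_leP[E|/(alt_lt_asym xy)//].
by apply: (@alt_ltxx _ _ false (sval x)); rewrite -{2}E.
Qed.

Definition mk_alt_line (f : nat -> omega1_top)
  (fP : exists N d, f = enum_trunc N d) : alt_line := exist _ f (asboolT fP).

Lemma alt_lineP (x : alt_line) : exists N d, sval x = enum_trunc N d.
Proof. exact/asboolP/(svalP x). Qed.

Lemma alt_line_stop (x : alt_line) m n :
  sval x m = None -> (m <= n)%N -> sval x n = None.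
Proof.
have [[N|] [d ->]] //= := alt_lineP x; case: ltnP => // Nm _ mn.
by rewrite ltnNge (leq_trans Nm mn).
Qed.

Lemma alt_line_trunc (n : nat) (x : alt_line) :
  exists N d, (fun m => if (m < n)%N then sval x m else None) = enum_trunc N d.
Proof.
have [[N|] [d ->]] := alt_lineP x.
  exists (Some (minn n N)), d; apply/funext => m /=.
  by rewrite leq_min; case: (m < n)%N.
by exists (Some n), d; apply/funext.
Qed.

Definition trunc n (x : alt_line) : alt_line := mk_alt_line (alt_line_trunc n x).

Lemma truncE n x m : sval (trunc n x) m = if (m < n)%N then sval x m else None.
Proof. by []. Qed.

(** * Limits of monotone [omega1]-sequences *)

Lemma alt_line_supremum b (x : omega1 -> alt_line) :
    (forall a a', (a <= a')%O -> alt_le b (sval (x a)) (sval (x a'))) ->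
  exists s : alt_line, (forall a, alt_le b (sval (x a)) (sval s)) /\
    forall y : alt_line, (forall a, alt_le b (sval (x a)) (sval y)) ->
      alt_le b (sval s) (sval y).
Proof.
move=> x_mono.
pose stable n a := forall a', (a <= a')%O -> sval (x a') n = sval (x a) n.
have bound n0 : (forall n, (n < n0)%N -> exists a, stable n a) ->
    exists a, forall n, (n < n0)%N -> stable n a.
  elim: n0 => [|n0 IH] st.
    have [|a _] := @omega1_strict_ubound set0; first exact: countable0.
    by exists a.
  have [n n0n|a aP] := IH; first by apply: st; rewrite ltnS ltnW.
  have [c cP] := st n0 (ltnSn n0).
  exists (Order.max a c) => n; rewrite ltnS leq_eqVlt => /orP[/eqP ->|nn0] a'.
    rewrite ge_max => /andP[_ ca']; rewrite cP // [RHS]cP //.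
    by rewrite le_max lexx orbT.
  rewrite ge_max => /andP[aa' _]; rewrite (aP n nn0) // [RHS](aP n nn0) //.
  by rewrite le_max lexx.
(* If every coordinate stabilises, the countably many stages have a common bound [a], and the
   sequence is constant from [a] on. *)
have [st|nst] := pselect (forall n, exists a, stable n a).
  have [c cP] := choice st.
  have [|a aP] := @omega1_strict_ubound (range c).
    exact: sub_countable (card_image_le _ _) (countableP _).
  have xa a' : (a <= a')%O -> sval (x a') = sval (x a).
    move=> aa'; have ca n : (c n < a)%O by apply: aP; exists n.
    apply/funext => n; rewrite (cP n a') 1?(cP n a) //; apply/ltW => //.
    exact: lt_le_trans aa'.
  exists (x a); split=> [a'|y]; last exact.
  by have [/x_mono //|/ltW/xa ->] := leP a' a; left.
(* Otherwise let [n] be the first coordinate that never stabilises; from [a0] on, all earlier ones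
   are constant. *)
have {nst} [n nstn nmin] : exists2 n, ~ (exists a, stable n a) &
    forall m, (m < n)%N -> exists a, stable m a.
  have /existsNP[n0 n0P] := nst.
  have [|n /asboolP nP nmin] := @ex_minnP (fun n => `[< ~ exists a, stable n a >]).
    by exists n0; apply/asboolP.
  exists n => // m mn; apply: contrapT => /asboolP/nmin.
  by rewrite leqNgt mn.
have [a0 a0P] := bound n nmin.
have agree a m : (a0 <= a)%O -> (m < n)%N -> sval (x a) m = sval (x a0) m.
  by move=> a0a mn; exact: a0P.
have coord a a' : (a0 <= a)%O -> (a <= a')%O -> sval (x a) n = sval (x a') n \/
    flip_lt (odd n (+) b) (sval (x a) n) (sval (x a') n).
  move=> a0a aa'; apply: alt_le_coord (x_mono _ _ aa') => m mn.
  by rewrite !agree // (le_trans a0a).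
(* On a reversed coordinate the values would decrease in a well-order and stabilise at their
   minimum. *)
case c_eq : (odd n (+) b) coord => coord.
  have [|v [a a0a <-] vmin] :=
      @omega1_top_min ((fun a => sval (x a) n) @` [set a | (a0 <= a)%O]).
    by exists (sval (x a0) n), a0 => //=.
  case: nstn; exists a => a' aa'; have [//|/= lt_a'] := coord a a' a0a aa'.
  have : (sval (x a) n <= sval (x a') n)%O.
    by apply: vmin; exists a' => //; exact: le_trans aa'.
  by rewrite leNgt lt_a'.
have grow a : (a0 <= a)%O -> exists2 a', (a <= a')%O & (sval (x a) n < sval (x a') n)%O.
  move=> a0a; apply: contrapT => na; apply: nstn; exists a => a' aa'.
  by have [//|lt_a'] := coord a a' a0a aa'; case: na; exists a'.
have mono a a' : (a0 <= a)%O -> (a <= a')%O -> (sval (x a) n <= sval (x a') n)%O.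
  by move=> a0a aa'; have [->|/ltW] := coord a a' a0a aa'.
have fin a : (a0 <= a)%O -> sval (x a) n != None.
  move=> a0a; have [a' _] := grow a a0a.
  rewrite -(lt_None (sval (x a) n)) => /lt_le_trans; apply.
  exact: (isT : (_ <= None :> omega1_top)%O).
(* Suppose the values stay at most [v]. Let [f w] be a stage where [w] is exceeded, for each
   [w <= v] that is exceeded, and let [a] lie above all of these. The value at [a] is exceeded
   later, hence already before [a], against monotonicity. *)
have unb v : exists2 a, (a0 <= a)%O & ((Some v : omega1_top) < sval (x a) n)%O.
  apply: contrapT => nv.
  have vP a : (a0 <= a)%O -> (sval (x a) n <= (Some v : omega1_top))%O.
    by move=> a0a; rewrite leNgt; apply/negP => va; apply: nv; exists a.
  have /choice[f fP] (w : omega1) : exists a, (exists2 a, (a0 <= a)%O &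
      ((Some w : omega1_top) < sval (x a) n)%O) ->
      (a0 <= a)%O /\ ((Some w : omega1_top) < sval (x a) n)%O.
    have [[a a0a wa]|nw] := pselect (exists2 a, (a0 <= a)%O &
        ((Some w : omega1_top) < sval (x a) n)%O); first by exists a.
    by exists a0.
  have [|a a0a aP] := @omega1_strict_ubound2 (f @` [set w | (w <= v)%O]) a0.
    exact: sub_countable (card_image_le _ _) (omega1_countable_le v).
  case xaE : (sval (x a) n) (fin a (ltW a0a)) => [w|//] _.
  have [a' aa'] := grow a (ltW a0a); rewrite xaE => wa'.
  have [|a0f wf] := fP w; first by exists a' => //; rewrite (le_trans (ltW a0a)).
  have fa : (f w < a)%O.
    by apply: aP; exists w => //=; have := vP a (ltW a0a); rewrite xaE.
  by have := mono _ _ a0f (ltW fa); rewrite xaE leNgt wf.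
have below a : (a0 <= a)%O -> alt_lt b (sval (x a)) (sval (trunc n (x a0))).
  move=> a0a; exists n => [m mn|]; first by rewrite truncE mn agree.
  by rewrite c_eq truncE ltnn /flip_lt lt_None fin.
exists (trunc n (x a0)); split=> [a|y yub].
  have [/below|/ltW/x_mono] := leP a0 a; first by right.
  by move=> /alt_le_lt_trans/(_ (below a0 (lexx _))); right.
(* Let a bound [y] lie below the truncation and differ from it first at [m]. If [m < n], then [y] is
   below [x a0]; if [m > n], both have stopped; if [m = n], some [x a] overtakes [y] at [n]. *)
apply: contrapT => /alt_ltNge[m ym]; rewrite truncE.
have contra a : alt_lt b (sval y) (sval (x a)) -> False.
  by move=> /(alt_le_lt_trans (yub a))/alt_ltxx.
have {}ym i : (i < m)%N -> sval y i = sval (trunc n (x a0)) i by exact: ym.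
case: (ltngtP m n) => [mn|nm|mn].
- move=> ltm; apply: (contra a0); exists m => // i im.
  by rewrite ym // truncE (ltn_trans im).
- rewrite (@alt_line_stop y n m) ?flip_ltxx //; last exact: ltnW.
  by rewrite ym // truncE ltnn.
- subst m; rewrite c_eq /flip_lt lt_None.
  case yE : (sval y n) => [v|//] _; have [a a0a va] := unb v.
  apply: (contra a); exists n; last by rewrite c_eq yE.
  by move=> i ni; rewrite ym // truncE ni agree.
Qed.

Lemma alt_line_bounded_limits : bounded_omega1_limits alt_line.
Proof.
split=> x x_mono _.
  have [|s [s_ub s_lub]] := @alt_line_supremum false x.
    by move=> a a' /x_mono/alt_line_leP.
  exists s; split=> [_ [a _ <-]|y y_ub]; first exact/alt_line_leP.
  by apply/alt_line_leP/s_lub => a; apply/alt_line_leP/y_ub; exists a.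
have [|s [s_ub s_lub]] := @alt_line_supremum true x.
  by move=> a a' /x_mono/alt_line_leP/(@alt_le_neg _ _ false).
exists s; split=> [_ [a _ <-]|y y_lb].
  exact/alt_line_leP/(@alt_le_neg _ _ false).
apply/alt_line_leP/(@alt_le_neg _ _ false)/s_lub => a.
by apply/(@alt_le_neg _ _ false)/alt_line_leP/y_lb; exists a.
Qed.

(** * Cardinality of the line *)

Lemma wf_lex_nat (X : Type) (r : X -> X -> Prop) : well_founded r ->
  well_founded (fun p q : X * nat => r p.1 q.1 \/ p.1 = q.1 /\ (p.2 < q.2)%N).
Proof.
move=> r_wf [a n]; elim/(well_founded_ind r_wf): a n => a IHa n.
elim/ltn_ind: n => n IHn.
constructor=> -[b m] [ba|[ba mn]]; first exact: IHa b ba m.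
by move: ba => /= ->; exact: IHn.
Qed.

(** Pairs of an ordinal and a number code the line; their lexicographic order is well-founded with
    countable initial segments, so it embeds into [omega1]. *)
Lemma alt_line_card : ([set: alt_line] #<= [set: omega1])%card.
Proof.
pose lt (p q : omega1 * nat) : Prop := (p.1 < q.1)%O \/ p.1 = q.1 /\ (p.2 < q.2)%N.
have lt_wf : well_founded lt. exact: wf_lex_nat omega1_wf.
have lt_countable p : countable [set q | lt q p].
  apply: (@sub_countable _ _ _ ([set a | (a <= p.1)%O] `*` [set: nat])).
    by apply: subset_card_le => -[b m] [/= /ltW //|[/= -> _]]; split=> /=.
  by apply: countableX; [exact: omega1_countable_le|exact: countableP].
have [g [_ g_lt]] := @omega1_embedding _ _ setT lt_wf lt_countable omega1_uncountable.
(* The number 0 marks the whole enumeration, [n.+1] its truncation to [n]. *)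
have /choice[r rP] (x : alt_line) : exists p : omega1 * nat,
    sval x = enum_trunc (if p.2 is n.+1 then Some n else None) p.1.
  by have [[n|] [d ->]] := alt_lineP x; [exists (d, n.+1)|exists (d, 0%N)].
have ncmp p q : g p = g q -> ~ lt p q by move=> gpq /g_lt; rewrite gpq ltxx.
have g_inj p q : g p = g q -> p = q.
  move: p q => [a m] [b n] gpq; have [ab|ba|ab] := ltgtP a b.
  - by case: (ncmp _ _ gpq); left.
  - by case: (ncmp _ _ (esym gpq)); left.
  - subst b; congr pair; case: (ltngtP m n) => // mn.
      by case: (ncmp _ _ gpq); right.
    by case: (ncmp _ _ (esym gpq)); right.
suff [h] : $|{injfun [set: alt_line] >-> [set: omega1]}| by exact: inj_card_le h.
apply/injfunPex; exists (g \o r) => // x y _ _ /= /g_inj rxy.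
by apply: val_inj; rewrite /= !rP rxy.
Qed.

(** * Branching of uncountable sets *)

Definition values (x : alt_line) : set omega1 :=
  [set a | exists n, sval x n = Some a].

(** Words code finite sequences, so that closing off under a function of words handles truncations;
    a word that is no truncation gives [None]. *)
Definition node (w : seq omega1) : option alt_line :=
  insub (fun n => nth None (map Some w) n).

Lemma node_trunc d n (x : alt_line) :
  sval x = enum_trunc None d -> node (mkseq (initial_enum d) n) = Some (trunc n x).
Proof.
move=> xE; rewrite /node -[RHS]valK; congr insub; apply/funext => m.
transitivity (if (m < n)%N then sval x m else None); last by [].
rewrite xE /=; case: ltnP => mn.
  by rewrite (nth_map d) ?size_mkseq // nth_mkseq.
by rewrite nth_default // size_map size_mkseq.
Qed.

(** Truncations are coded by words over a countable alphabet. A whole enumeration with values below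
    [b] belongs to some [d <= b], for otherwise [b] would be one of its values. *)
Lemma countable_values_below (b : omega1) :
  countable [set x : alt_line | forall a, values x a -> (a < b)%O].
Proof.
pose S := [set w : seq omega1 | forall a, a \in w -> (a < b)%O].
have cS : countable S by exact: countable_seq (omega1_countable_lt b).
have cN : countable [set x : alt_line | exists2 w, S w & node w = Some x].
  have cI : countable (node @` S) by exact: sub_countable (card_image_le _ _) cS.
  rewrite /countable -card_ge_some; apply: sub_countable cI.
  by apply: subset_card_le => _ [x [w Sw wx] <-]; exists w.
have cB : countable [set x : alt_line |
    exists2 d, (d <= b)%O & sval x = enum_trunc None d].
  have /countable_injP[f finj] := omega1_countable_le b.
  have /choice[r rP] (x : alt_line) : exists d, 
      (exists2 d, (d <= b)%O & sval x = enum_trunc None d) ->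
      (d <= b)%O /\ sval x = enum_trunc None d.
    have [[d db xd]|nx] := pselect (exists2 d, (d <= b)%O & sval x = enum_trunc None d).
      by exists d.
    by exists b.
  apply/countable_injP; exists (f \o r) => x y; rewrite !inE => /rP[xb xE] /rP[yb yE].
  by move=> /= /finj; rewrite !inE => /(_ xb yb) rxy; apply: val_inj; rewrite /= xE yE rxy.
apply: (@sub_countable _ _ _ ([set x | exists2 w, S w & node w = Some x] `|`
  [set x : alt_line | exists2 d, (d <= b)%O & sval x = enum_trunc None d])).
  apply: subset_card_le => x xb; have [[n|] [d xE]] := alt_lineP x; [left|right].
    pose y := mk_alt_line (ex_intro _ None (ex_intro _ d erefl)) : alt_line.
    have xy : x = trunc n y by apply: val_inj; rewrite /= xE.
    exists (mkseq (initial_enum d) n); last by rewrite (@node_trunc d n y) // xy.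
    move=> a /mapP[i]; rewrite mem_iota => /= ni ->; apply: xb.
    by exists i; rewrite xE /= ni.
  exists d => //; rewrite leNgt; apply/negP => bd.
  have [|n nb] := (@initial_enumP d _ b).2 bd; first by exists b.
  have : (b < b)%O by apply: xb; exists n; rewrite xE /= nb.
  by rewrite ltxx.
rewrite -bigcup2E; apply: bigcup_countable => // -[|[|i]] _ //=.
Qed.

(* If every node had only countably many successors in [A], the subtree
   generated by [A] would be countable and its values would be bounded. *)
Lemma uncountable_branching (A : set alt_line) : ~ countable A ->
  exists (n : nat) (t : nat -> omega1_top),
    ~ countable [set a : omega1 | exists x, [/\ A x,
        forall m, (m < n)%N -> sval x m = t m & sval x n = Some a]].
Proof.
move=> ncA; apply: contrapT => nbr; apply: ncA.
have cbr n t : countable [set a : omega1 | exists x, [/\ A x,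
    forall m, (m < n)%N -> sval x m = t m & sval x n = Some a]].
  by apply: contrapT => nc; apply: nbr; exists n, t.
(* [P n] is level [n] of the tree generated by [A]; each of its nodes extends by countably many
   values or by [None]. *)
pose P n := (fun x : alt_line => mkseq (sval x) n) @` A.
have cP n : countable (P n).
  elim: n => [|n IHn].
    by apply: (@sub_countable _ _ _ [set [::]]) => //; apply: subset_card_le => _ [x _ <-].
  pose Q (u : seq omega1_top) := [set a : omega1 | exists x, [/\ A x,
    forall m, (m < n)%N -> sval x m = nth None u m & sval x n = Some a]].
  have cQ : countable (\bigcup_(u in P n) ((rcons u \o Some) @` Q u `|` [set rcons u None])).
    apply: bigcup_countable => // u _; rewrite -bigcup2E.
    apply: bigcup_countable => // -[|[|i]] _ //=.
    exact: sub_countable (card_image_le _ _) (cbr n (nth None u)).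
  apply: sub_countable cQ; apply: subset_card_le => _ [x Ax <-].
  exists (mkseq (sval x) n); first by exists x.
  rewrite mkseqS; case xn: (sval x n) => [a|]; [left|by right].
  by exists a => //; exists x; split=> // m mn; rewrite nth_mkseq.
have cV : countable (\bigcup_n \bigcup_(u in P n)
    [set a | exists x, [/\ A x, forall m, (m < n)%N -> sval x m = nth None u m
                         & sval x n = Some a]]).
  by apply: bigcup_countable => // n _; apply: bigcup_countable.
have [b bV] := omega1_strict_ubound cV.
apply: sub_countable (countable_values_below b); apply: subset_card_le.
move=> x Ax a [n xn]; apply: bV; exists n => //; exists (mkseq (sval x) n).
  by exists x.
by exists x; split=> // m mn; rewrite nth_mkseq.
Qed.

Lemma alt_line_contains_omega1 (A : set alt_line) : ~ countable A ->
  contains_copy_of omega1 A \/ contains_copy_of (omega1^d) A.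
Proof.
move=> /uncountable_branching[n [t ncV]].
have [g [gV g_lt]] := omega1_embedding omega1_wf omega1_countable_lt ncV.
have [f fP] := choice gV.
(* With the flag [odd n], coordinate [n] carries the direct order of [omega1]; for odd [n] this is
   the reverse of the order of the line. *)
have f_lt a b : (a < b)%O ->
    alt_lt (odd n) (sval (f a)) (sval (f b)).
  move=> /g_lt gab; have [[_ fa fan] [_ fb fbn]] := (fP a, fP b).
  exists n => [m mn|]; first by rewrite fa // fb.
  by rewrite addbb /= fan fbn lt_Some.
have subA : range f `<=` A by move=> _ [a _ <-]; have [] := fP a.
case: (odd n) f_lt => f_lt; [right|left]; exists (range f) => //; exists f; split=> //.
  have {}f_lt (a b : omega1^d) : (a < b)%O -> (f a < f b)%O.
    by move=> /f_lt/(@alt_lt_neg _ _ false)/alt_line_ltP.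
  by apply: le_mono => a b; exact: f_lt.
by apply: le_mono => a b /f_lt/alt_line_ltP.
Qed.

(** * Final segments and the jumps of continuous functions on them *)

Section FinalSegments.
Context (disp : Order.disp_t) (X : orderType disp).

Definition seg_mem (F : final_segments X) (x : X) : bool := (sval F : X -> bool) x.

Arguments seg_mem : simpl never.

Lemma seg_mem_le (F : final_segments X) x y :
  (x <= y)%O -> seg_mem F x -> seg_mem F y.
Proof.
rewrite /seg_mem; case: F => /= u /set_mem[F Ffin <-] xy; rewrite /char_fun.
by rewrite !inE => Fx; exact: Ffin Fx xy.
Qed.

Definition mk_seg (A : set X) (Afin : final_segment A) : final_segments X :=
  exist _ (char_fun A) (mem_set (ex_intro2 _ _ A Afin erefl)).

Lemma closed_ray_final (z : X) : final_segment [set x | (z <= x)%O].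
Proof. by move=> x y /= zx; exact: le_trans. Qed.

Lemma open_ray_final (z : X) : final_segment [set x | (z < x)%O].
Proof. by move=> x y /= zx; exact: lt_le_trans. Qed.

Definition closed_ray z := mk_seg (@closed_ray_final z).
Definition open_ray z := mk_seg (@open_ray_final z).

Lemma closed_rayE z x : seg_mem (closed_ray z) x = (z <= x)%O.
Proof. by rewrite /seg_mem /= /char_fun; apply/idP/idP; rewrite inE. Qed.

Lemma open_rayE z x : seg_mem (open_ray z) x = (z < x)%O.
Proof. by rewrite /seg_mem /= /char_fun; apply/idP/idP; rewrite inE. Qed.

Lemma open_seg_mem x b : open [set F : final_segments X | seg_mem F x = b].
Proof.
have -> : [set F : final_segments X | seg_mem F x = b] =
    (fun F : final_segments X => seg_mem F x) @^-1` [set b] by [].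
apply: open_comp; last exact: discrete_open.
move=> F _; apply: (@continuous_comp _ _ _ (set_val : final_segments X -> cantor_cube X)
  (@proj X (fun=> bool) x)).
  exact: initial_continuous.
exact: proj_continuous.
Qed.

Lemma cvg_final_segments (T : Type) (G : set_system T) {FG : Filter G}
    (w : T -> final_segments X) (F : final_segments X) :
  (forall x, \forall t \near G, seg_mem (w t) x = seg_mem F x) -> w @ G --> F.
Proof.
move=> wF; have cvgv : (set_val \o w : T -> cantor_cube X) @ G -->
    (set_val F : cantor_cube X).
  apply/cvg_sup => x A /= [_ [[B Bop <-] BF BA]].
  rewrite /nbhs /=; apply: filterS (wF x) => t wtF; apply: BA => /=.
  by rewrite -[X in B X]/(seg_mem (w t) x) wtF.
move=> A /= [_ [[B Bop <-] BF BA]]; rewrite /nbhs /=.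
have : nbhs (set_val F : cantor_cube X) B by exact: open_nbhs_nbhs.
by move=> /cvgv; rewrite /nbhs /=; apply: filterS => t; exact: BA.
Qed.

Lemma open_seg_separation (s t : X) :
  open [set F : final_segments X | seg_mem F s <> seg_mem F t].
Proof.
have -> : [set F : final_segments X | seg_mem F s <> seg_mem F t] =
    \bigcup_b ([set F | seg_mem F s = b] `&` [set F | seg_mem F t = ~~ b]).
  apply/seteqP; split=> F /=.
    by move=> Fst; exists (seg_mem F s) => //; split=> //=; move: Fst;
       case: (seg_mem F s); case: (seg_mem F t).
  by move=> [b _ [/= -> ->]]; case: b.
by apply: bigcup_open => b _; apply: openI; exact: open_seg_mem.
Qed.

Lemma seg_separation_nonempty (s t : X) : s <> t ->
  [set F : final_segments X | seg_mem F s <> seg_mem F t] !=set0.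
Proof.
move=> /eqP; rewrite neq_lt => /orP[st|ts]; [exists (closed_ray t)|exists (closed_ray s)];
  by rewrite /= !closed_rayE lexx leNgt ?st ?ts.
Qed.

Lemma ultra_fmap (S T : Type) (f : S -> T) (G : set_system S) :
  UltraFilter G -> UltraFilter (f @ G).
Proof.
move=> GU; split; first exact: fmap_proper_filter.
move=> H HP GH; apply/seteqP; split=> [B HB|//].
have [//|nB] := in_ultra_setVsetC (f @^-1` B) GU.
have : H (B `&` ~` B) by apply: filterI => //; exact: GH.
by rewrite setICr => /filter_ex[].
Qed.

(** Only finitely many jumps exceed a given size: along an ultrafilter on infinitely many of them
    the closed rays converge by compactness, the open rays have the same limit, and continuity
    forces the jumps to 0. *)
Lemma countable_jumps (R : realType) (h : final_segments X -> R) :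
  compact [set: final_segments X] -> continuous h ->
  countable [set z | h (closed_ray z) <> h (open_ray z)].
Proof.
move=> cK ch.
pose J n := [set z : X | (n.+1%:R^-1 < `|h (closed_ray z) - h (open_ray z)|)%R].
apply: (@sub_countable _ _ _ (\bigcup_n J n)).
  apply: subset_card_le => z /= /eqP; rewrite -subr_eq0 -normr_gt0 => hz.
  have [n _ nz] := near_infty_natSinv_lt (PosNum hz).
  by exists n => //; apply: nz => /=.
apply: bigcup_countable => // n _; apply: finite_set_countable.
apply: contrapT => Jinf.
pose G0 : set_system X := [set B | finite_set (J n `\` B)].
have G0P : ProperFilter G0.
  apply: Build_ProperFilter_ex => [B GB|].
    have [//|B0] := pselect (B !=set0); case: Jinf.
    apply: sub_finite_set GB => z Jz; split=> // Bz; apply: B0; by exists z.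
  split=> [|B C GB GC|B C BC GB]; rewrite /G0 /=.
  - by rewrite setDT; exact: finite_set0.
  - by rewrite setDIr finite_setU.
  - by apply: sub_finite_set GB => z [Jz nC]; split=> // /BC.
have [G [GU G0G]] := ultraFilterLemma G0P.
have := cK; rewrite compact_ultra => /(_ _ (ultra_fmap closed_ray GU) filterT).
move=> [F [_ /= cF]].
(* The two rays at [t] differ only in the point [t], and [G] contains the complement of every
   point. *)
have oF : open_ray @ G --> F.
  apply: cvg_final_segments => x.
  have Gx : G [set t | t <> x].
    apply: G0G; apply: (@sub_finite_set _ _ [set x]); last exact: finite_set1.
    by move=> z [_ /contrapT].
  have Fx : \forall t \near G, seg_mem (closed_ray t) x = seg_mem F x.
    apply: (cF [set H | seg_mem H x = seg_mem F x]); apply: open_nbhs_nbhs.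
    by split=> //; exact: open_seg_mem.
  apply: filterS2 Gx Fx => t /eqP tx <-.
  by rewrite closed_rayE open_rayE lt_neqAle tx.
have hc : (h \o closed_ray) @ G --> h F by apply: cvg_comp cF (ch F).
have ho : (h \o open_ray) @ G --> h F by apply: cvg_comp oF (ch F).
have n0 : (0 < n.+1%:R^-1 :> R)%R by rewrite invr_gt0.
have hco : (fun z => h (closed_ray z) - h (open_ray z))%R @ G --> (0 : R)%R.
  by rewrite -(subrr (h F)); exact: (cvgB hc ho).
have small : \forall z \near G,
    (`|h (closed_ray z) - h (open_ray z)| < n.+1%:R^-1)%R.
  exact: (iffLR (cvgr0Pnorm_lt _)) hco _ n0.
have GJ : G (J n) by apply: G0G; rewrite /G0 /= setDv; exact: finite_set0.
have [z [/= Jz]] := @filter_ex _ G _ _ (@filterI _ G _ _ _ GJ small).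
by move=> /(lt_trans Jz); rewrite ltxx.
Qed.
End FinalSegments.

(** * Approximation of a branch by its truncations *)

Lemma trunc_cmp k (x : alt_line) : sval x k <> None ->
  if odd k then (trunc k x < x)%O else (x < trunc k x)%O.
Proof.
move=> xk; have lt_k : alt_lt (odd k) (sval x) (sval (trunc k x)).
  exists k => [m mk|]; first by rewrite truncE mk.
  by rewrite addbb truncE ltnn /= lt_None; apply/eqP.
case: (odd k) lt_k => [/(@alt_lt_neg _ _ false)|] lt_k; exact/alt_line_ltP.
Qed.

Lemma trunc_lt_near (y z : alt_line) : (y < z)%O ->
  exists m, forall k, (m <= k)%N -> (y < trunc k z)%O.
Proof.
move=> /alt_line_ltP/alt_lt_near_r[m mP]; exists m => k mk.
by apply/alt_line_ltP/mP => i im; rewrite truncE (leq_trans im).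
Qed.

Lemma trunc_gt_near (y z : alt_line) : (z < y)%O ->
  exists m, forall k, (m <= k)%N -> (trunc k z < y)%O.
Proof.
move=> /alt_line_ltP/alt_lt_near_l[m mP]; exists m => k mk.
by apply/alt_line_ltP/mP => i im; rewrite truncE (leq_trans im).
Qed.

Definition branch (d : omega1) : alt_line :=
  mk_alt_line (ex_intro _ None (ex_intro _ d erefl)).

Lemma branchE d n : sval (branch d) n = Some (initial_enum d n).
Proof. by []. Qed.

(* The truncations of odd length lie below the branch and those of even length
   above it, so that the parity decides which end of the jump is the limit. *)
Lemma cvg_separating_truncations (p : bool) d (w : nat -> final_segments alt_line) :
    (forall i, seg_mem (w i) (trunc (i.*2 + p) (branch d)) <>
               seg_mem (w i) (trunc (i.*2 + p).+2 (branch d))) ->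
  w @ \oo --> if p then closed_ray (branch d) else open_ray (branch d).
Proof.
move=> w_sep; set z := branch d in w_sep *.
(* A final segment that separates two points contains all that lies above both and nothing that lies
   below both. *)
have in_w i y : (trunc (i.*2 + p) z <= y)%O -> (trunc (i.*2 + p).+2 z <= y)%O ->
    seg_mem (w i) y = true.
  move=> sy ty; apply/negPn/negP => /negP nwy; apply: (w_sep i).
  by apply/idP/idP => /seg_mem_le h; case: nwy; exact: h.
have notin_w i y : (y <= trunc (i.*2 + p) z)%O -> (y <= trunc (i.*2 + p).+2 z)%O ->
    seg_mem (w i) y = false.
  move=> ys yt; apply/negP => wy; apply: (w_sep i).
  by rewrite (seg_mem_le ys wy) (seg_mem_le yt wy).
have index_large m i : (m <= i)%N -> (m <= i.*2 + p)%N.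
  by move=> mi; rewrite (leq_trans mi) // -addnn -addnA leq_addr.
have index_odd i : odd (i.*2 + p) = p by rewrite oddD odd_double oddb.
apply: cvg_final_segments => y; have [yz|zy|->] := ltgtP y z.
- have [m mP] := trunc_lt_near yz; exists m => // i /= /index_large mi.
  rewrite notin_w; try by apply/ltW/mP; rewrite ?(leqW (leqW mi)).
  by case: (p); rewrite ?closed_rayE ?open_rayE ?(lt_gtF yz) // leNgt yz.
- have [m mP] := trunc_gt_near zy; exists m => // i /= /index_large mi.
  rewrite in_w; try by apply/ltW/mP; rewrite ?(leqW (leqW mi)).
  by case: (p); rewrite ?closed_rayE ?open_rayE ?zy // ltW.
- apply: nearW => i; have zk k : sval z k <> None by [].
  have := trunc_cmp (zk (i.*2 + p)%N); have := trunc_cmp (zk (i.*2 + p).+2).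
  rewrite /= negbK index_odd; case: (p) in in_w notin_w * => zt zs.
    by rewrite in_w ?closed_rayE ?lexx // ltW.
  by rewrite notin_w ?open_rayE ?ltxx // ltW.
Qed.

(** * Failure of the Valdivia property *)

Lemma countable_values (x : alt_line) : countable (values x).
Proof.
rewrite /countable -card_ge_some.
apply: (@sub_countable _ _ _ (range (sval x))); last first.
  exact: sub_countable (card_image_le _ _) (countableP _).
by apply: subset_card_le => _ [a [n xn] <-]; exists n.
Qed.

Lemma alt_line_not_valdivia (R : realType) : ~ valdivia R (final_segments alt_line).
Proof.
move=> [cK [Gamma [K' [[f [g [cf cg fK gK]]] dense_sigma]]]].
pose coord (c : Gamma) (F : final_segments alt_line) : R := sval (f F) c.
have coord_cont c : continuous (coord c).
  move=> F; apply: (@continuous_comp _ _ _ f (fun x : K' => sval x c : R)).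
    exact: cf.
  apply: (@continuous_comp _ _ _ (set_val : K' -> prod_topology (fun=> R))
    (@proj {classic Gamma} (fun=> R) c)).
    exact: initial_continuous.
  exact: proj_continuous.
pose jumps c := [set z | coord c (closed_ray z) <> coord c (open_ray z)].
pose supp F := [set c | coord c F != 0%R].
have /choice[point pointP] (st : alt_line * alt_line) :
    exists F : final_segments alt_line, st.1 <> st.2 ->
      seg_mem F st.1 <> seg_mem F st.2 /\ countable (supp F).
  have [->|st_neq] := pselect (st.1 = st.2).
    by exists (closed_ray st.2).
  have [||x [xst cx]] := dense_sigma (g @^-1` [set F | seg_mem F st.1 <> seg_mem F st.2]).
  - have [F FP] := seg_separation_nonempty st_neq.
    by exists (f F); rewrite /= fK.
  - by apply: open_comp => [x _|]; [exact: cg|exact: open_seg_separation].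
  - exists (g x) => _; split=> //.
    by rewrite /supp /coord gK.
pose bad (s t : alt_line) := \bigcup_(c in supp (point (s, t))) jumps c.
have bad_countable s t : s <> t -> countable (bad s t).
  move=> st; apply: bigcup_countable => [|c _]; first by have [] := pointP (s, t) st.
  exact: countable_jumps (coord_cont c).
(* A word [w] codes the pair of [w] without its last two letters and [w]. Lengths differing by two
   have equal parity, so both truncations lie on the same side of the branch. *)
have /choice[phi phiP] (w : seq omega1) : exists b : omega1, forall s t z,
    node (take (size w - 2) w) = Some s -> node w = Some t -> s <> t ->
    bad s t z -> forall a, values z a -> (a < b)%O.
  have trivial_bound (P : omega1 -> Prop) : (forall b, P b) -> exists b, P b.
    by move=> allP; have [|b _] := @omega1_strict_ubound set0; [|exists b].
  case ws: (node (take _ w)) => [s|]; last exact: trivial_bound.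
  case wt: (node w) => [t|]; last exact: trivial_bound.
  have [st|st] := pselect (s = t).
    by apply: trivial_bound => b s' t' z [<-] [<-].
  have [|b bP] := @omega1_strict_ubound (\bigcup_(z in bad s t) values z).
    apply: bigcup_countable => [|z _]; first exact: bad_countable.
    exact: countable_values.
  by exists b => s' t' z [<-] [<-] _ bz a za; apply: bP; exists z.
have [d [d_gt0 d_closed]] := omega1_closed_point phi.
pose z := branch d.
have [c cz] : exists c, jumps c z.
  apply: contrapT => /forallNP nj.
  have : closed_ray z = open_ray z.
    apply: (can_inj fK); apply: val_inj; apply/funext => c.
    exact: contrapT (nj c).
  move=> /(congr1 (fun F : final_segments alt_line => seg_mem F z)).
  by rewrite closed_rayE open_rayE lexx ltxx.
(* The parity [p] is chosen so that the truncations used below lead to an end of the jump where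
   [coord c] is nonzero. *)
have [p pz] : exists p : bool,
    coord c (if p then closed_ray z else open_ray z) <> 0%R.
  have [c0|] := pselect (coord c (closed_ray z) = 0%R); last by exists true.
  by exists false => /= o0; apply: cz; rewrite c0 o0.
pose s i := trunc (i.*2 + p) z; pose t i := trunc (i.*2 + p).+2 z.
have st i : s i <> t i.
  move=> /(congr1 (fun x : alt_line => sval x (i.*2 + p)%N)).
  by rewrite !truncE ltnn ltnS leqnSn.
have w_cvg := @cvg_separating_truncations p d (fun i => point (s i, t i))
  (fun i => (pointP (s i, t i) (st i)).1).
have [i ci] : exists i, coord c (point (s i, t i)) != 0%R.
  apply: contrapT => /forallNP ci; apply: pz.
  have c0 : (fun i => coord c (point (s i, t i))) = (fun=> 0%R).
    by apply/funext => i; apply/eqP/negPn/negP; exact: ci.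
  have := cvg_comp _ _ w_cvg (coord_cont c _).
  rewrite -[_ \o _]/(fun i => coord c (point (s i, t i))) c0.
  by move=> /(cvg_lim (@Rhausdorff R)) <-; exact: lim_cst.
pose w := mkseq (initial_enum d) (i.*2 + p).+2.
have enum_lt n : (initial_enum d n < d)%O.
  by apply/(initial_enumP d_gt0); exists n.
(* By closure [phi w] lies below [d], so it is itself a value of [z]; but [z] is in the bad set of
   the pair coded by [w], whose values are all below [phi w]. *)
have [|n nphi] := (initial_enumP d_gt0 (phi w)).2.
  by apply: d_closed => a /mapP[n _ ->].
suff : (phi w < phi w)%O by rewrite ltxx.
apply: (phiP w (s i) (t i) z) (st i) _ _ _.
- rewrite size_mkseq subSS subSS subn0 /w /mkseq -map_take take_iota.
  by rewrite (minn_idPl (leqW (leqnSn _))) -/(mkseq _ _) (@node_trunc d _ z).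
- by rewrite (@node_trunc d _ z).
- by exists c.
- by exists n; rewrite branchE nphi.
Qed.

Theorem mainTheorem2 (R : realType) :
  exists (d : Order.disp_t) (Z : orderType d),
    [/\ ([set: Z] #<= [set: omega1])%card,
        bounded_omega1_limits Z,
        (forall A : set Z, ~ countable A ->
           contains_copy_of omega1 A \/ contains_copy_of (omega1^d) A)
      & ~ valdivia R (final_segments Z)].
Proof.
exists alt_line_display, alt_line; split.
- exact: alt_line_card.
- exact: alt_line_bounded_limits.
- exact: alt_line_contains_omega1.
- exact: alt_line_not_valdivia.
Qed.
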